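(* Let $r\ge 0$ be a real number, let $p\ge 0$ be an integer, and let $x\in\mathbb{C}$ with $|x|<2$. Put $n_0=1$ if $p\ge1$ and $n_0=0$ if $p=0$. Then $$\sum_{n=n_0}^{\infty}\binom{n+r}{n}n^{p}\left\{1-\eta(n+r+1)\right\}x^{n}=\frac{1}{\Gamma(r+1)}\sum_{j=0}^{p}S(p,j)\,\Gamma(r+j+1)\,\eta(r+j+1,2-x)\,x^{j}.$$ In particular, when $r=p=0$, $$\sum_{n=0}^{\infty}\left\{1-\eta(n+1)\right\}x^{n}=\eta(1,2-x).$$
   Context: $S(p,j)$ denotes the Stirling numbers of the second kind, with $S(0,0)=1$. $\binom{n+r}{n}=\frac{\Gamma(n+r+1)}{\Gamma(r+1)\,n!}$. For $\mathrm{Re}\,a>0$ and $\mathrm{Re}\,s>0$, $\eta(s,a)=\sum_{n=0}^{\infty}\frac{(-1)^{n}}{(n+a)^{s}}$ (Lerch's eta function) and $\eta(s)=\eta(s,1)$ (Euler's eta function). Conventions: $n^0=1$ for all $n\geq0$ and $x^0=1$. *)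

(* Defs.v *)
From Stdlib Require Import Reals Factorial.
From Coquelicot Require Import Coquelicot.

Open Scope R_scope.

(* Euler's integral of the second kind.  Only real arguments z > 0, where it
   converges, are meaningful. *)
Definition Gamma (z : R) : R :=
  RInt_gen (fun t => Rpower t (z - 1) * exp (- t))
    (at_right 0) (Rbar_locally p_infty).

(* Binomial coefficient with a real upper entry, "n + r choose n". *)
Definition gbinom (r : R) (n : nat) : R :=
  Gamma (INR n + r + 1) / (Gamma (r + 1) * INR (fact n)).

Fixpoint stirling2 (p j : nat) : nat :=
  match p, j with
  | O, O => 1
  | O, S _ => 0
  | S _, O => 0
  | S p', S j' => (j * stirling2 p' j + stirling2 p' j')%nat
  end.

Definition Cexp (z : C) : C :=
  (exp (Re z) * cos (Im z), exp (Re z) * sin (Im z)).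

(* Principal argument, with values in (-PI, PI]; z = 0 is a junk case. *)
Definition Carg (z : C) : R :=
  if Rle_dec 0 (Im z) then acos (Re z / Cmod z) else - acos (Re z / Cmod z).

Definition Clog (z : C) : C := (ln (Cmod z), Carg z).

(* Principal branch of the complex power z ^ s, for z <> 0.  (Coquelicot's Cpow,
   written z ^ n, has a natural exponent.) *)
Definition Cpower (z s : C) : C := Cexp (s * Clog z)%C.

(* The sum of a complex series, in the sense of convergence of the partial sums;
   unspecified when the series diverges. *)
Definition CSeries (u : nat -> C) : C :=
  iota (T := C_CompleteNormedModule)
    (fun l : C => is_series (V := C_NormedModule) u l).

(* Lerch's eta function, meaningful for Re s > 0 and Re a > 0.  For Re s <= 1
   the series is only conditionally convergent. *)
Definition eta (s a : C) : C :=
  CSeries (fun n => (RtoC ((-1) ^ n) / Cpower (RtoC (INR n) + a) s)%C).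

(* Euler's eta function. *)
Definition euler_eta (s : C) : C := eta s (RtoC 1).

(* Main.v *)
Require Import Defs.
From Stdlib Require Import Reals Factorial Lra Lia.
From Coquelicot Require Import Coquelicot.

Open Scope R_scope.

(** Write [s = r + 1].  The term of index 0 in the alternating series for
    [euler_eta (n + s)] is 1, so [1 - euler_eta (n + s)] is the alternating sum
    of [1 / (m + 2) ^ (n + s)] over [m >= 0].  For a fixed [m], the binomial
    series gives, as [|x| < 2 <= m + 2],
      sum over n of [gbinom r n * x ^ n / (m + 2) ^ (n + s)]
      = [1 / (m + 2 - x) ^ s]
    ([is_series_binomial]), and the alternating sum over [m] of the right-hand
    sides is [eta s (2 - x)].  This is the case [p = 0] ([eta_series]), up to
    the exchange of the two sums.

    The double series is not absolutely convergent when [r = 0], so the exchange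
    rests on the bound for the remainder of an alternating series: truncating
    the sum over [m] after index [N] changes [1 - euler_eta (n + s)] by at most
    [(N + 3) ^ - (n + s) <= 2 ^ - n / (N + 3)] ([one_minus_euler_eta]).  Summed
    against [gbinom r n * |x| ^ n], which converges because [|x| / 2 < 1], the
    error is a constant over [N + 3].  The same estimate proves that the series
    defining [eta s (2 - x)] converges, which is not obvious when [r = 0].

    For general [p], expand [n ^ p] in falling factorials, with the Stirling
    numbers as coefficients ([pow_stirling2]).  Multiplying [gbinom r n] by the
    falling factorial of length [j] turns it into a constant multiple of
    [gbinom (r + j) (n - j)] ([gbinom_falling]), so the [j]-th part is the case
    [p = 0] for [r + j], shifted by [j] and multiplied by [x ^ j]
    ([falling_eta_series]).

    The binomial series is obtained from its first-order differential equation
    along the segment from 0 to [y]; the only facts about [Gamma] that enter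
    are its positivity and functional equation on [[1, +oo)], which are derived
    from the integral. *)

(** The operations of the algebraic hierarchy leave equations whose type is a
    structure projection, which [ring] and [field] do not recognise. *)
Ltac eq_in T := match goal with |- @eq _ ?a ?b => change (@eq T a b) end.

(** * The Gamma integral for arguments at least 1 *)

Lemma RInt_pos_split (f : R -> R) (a b c : R) :
  (forall t, 0 < t -> continuous f t) ->
  0 < a -> a <= b -> b <= c -> RInt f a c = RInt f a b + RInt f b c.
Proof.
  intros Hc Ha Hab Hbc.
  symmetry; apply (RInt_Chasles (V := R_CompleteNormedModule) f a b c); apply (ex_RInt_continuous (V := R_CompleteNormedModule)); intros t Ht;
    apply Hc; rewrite Rmin_left in Ht by lra; lra.
Qed.

(** The integral of a nonnegative function grows with the interval, so a bound
    forces convergence at both ends at once, to the supremum of the integrals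
    over [[a, b]]. *)
Lemma is_RInt_gen_pos (f : R -> R) (M : R) :
  (forall t, 0 < t -> continuous f t) ->
  (forall t, 0 < t -> 0 <= f t) ->
  (forall a b, 0 < a -> a < b -> RInt f a b <= M) ->
  exists L,
    is_RInt_gen f (at_right 0) (Rbar_locally p_infty) L /\
    (forall a b, 0 < a -> a < b -> RInt f a b <= L).
Proof.
  intros Hc Hp HM.
  assert (Hex : forall a b, 0 < a -> a <= b -> ex_RInt f a b).
  { intros a b Ha Hab. apply (ex_RInt_continuous (V := R_CompleteNormedModule)). intros t Ht.
    apply Hc. rewrite Rmin_left in Ht by lra; lra. }
  assert (H0 : forall a b, 0 < a -> a <= b -> 0 <= RInt f a b).
  { intros a b Ha Hab. apply RInt_ge_0; auto.
    intros t Ht; apply Hp; lra. }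
  destruct (completeness (fun v => exists a b, 0 < a < b /\ v = RInt f a b))
    as [L [HL1 HL2]].
  - exists M. intros v (a & b & Hab & ->). apply HM; lra.
  - exists (RInt f 1 2), 1, 2. split; [lra | reflexivity].
  - assert (HL : forall a b, 0 < a -> a < b -> RInt f a b <= L).
    { intros a b Ha Hab. apply HL1. exists a, b; split; auto; lra. }
    exists L; split; auto.
    apply filterlimi_locally. intros eps.
    assert (Hab : exists a0 b0, 0 < a0 < b0 /\ L - eps < RInt f a0 b0).
    { destruct (Classical_Prop.classic
        (exists a0 b0, 0 < a0 < b0 /\ L - eps < RInt f a0 b0)) as [H | H]; auto.
      exfalso. assert (L <= L - eps).
      { apply HL2. intros v (a & b & Hab & ->).
        destruct (Rle_or_lt (RInt f a b) (L - eps)); auto.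
        exfalso; apply H; exists a, b; auto. }
      destruct eps as [e He]; simpl in *; lra. }
    destruct Hab as (a0 & b0 & Hab & HL0).
    exists (fun a => 0 < a < a0) (fun b => b0 < b).
    + assert (Ha0 : 0 < a0) by lra.
      exists (mkposreal a0 Ha0). intros a Ha Hpos. split; auto.
      apply Rabs_def2 in Ha. unfold minus, plus, opp in Ha; simpl in Ha. lra.
    + exists b0. auto.
    + intros a b Ha Hb. exists (RInt f a b). split.
      * simpl. apply (RInt_correct (V := R_CompleteNormedModule)). apply Hex; lra.
      * assert (RInt f a0 b0 <= RInt f a b).
        { rewrite (RInt_pos_split f a a0 b), (RInt_pos_split f a0 b0 b)
            by (auto; lra).
          generalize (H0 a a0) (H0 b0 b). lra. }
        assert (RInt f a b <= L) by (apply HL; lra).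
        apply Rabs_def1; unfold minus, plus, opp; simpl; lra.
Qed.

Lemma gamma_integrand_continuous (z t : R) :
  0 < t -> continuous (fun t => Rpower t (z - 1) * exp (- t)) t.
Proof.
  intros Ht. apply (ex_derive_continuous (V := R_NormedModule)).
  unfold Rpower. auto_derive. auto.
Qed.

Lemma gamma_integrand_pos (z t : R) : 0 < Rpower t (z - 1) * exp (- t).
Proof. apply Rmult_lt_0_compat; [apply exp_pos | apply exp_pos]. Qed.

Lemma ln_le_linear (c t : R) : 0 < c -> 0 < t -> ln t <= t / c + ln c.
Proof.
  intros Hc Ht.
  replace t with (t / c * c) at 1 by (field; lra).
  assert (0 < t / c) by (apply Rdiv_lt_0_compat; auto).
  rewrite ln_mult by auto.
  assert (ln (t / c) <= t / c); [| lra].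
  generalize (exp_ineq1_le (ln (t / c))). rewrite exp_ln by auto. lra.
Qed.

(** [exp (- t / 2)] absorbs any power of [t]: the linear bound on [ln] is used
    with slope [1 / (2 * z)], so that [(z - 1) * ln t <= t / 2 + const]. *)
Lemma gamma_integrand_le (z : R) :
  1 <= z ->
  exists K, 0 < K /\
    forall t, 0 < t -> Rpower t (z - 1) * exp (- t) <= K * exp (- t / 2).
Proof.
  intros Hz. exists (exp ((z - 1) * ln (2 * z))). split; [apply exp_pos |].
  intros t Ht. unfold Rpower. rewrite <- !exp_plus.
  assert (H : (z - 1) * ln t <= (z - 1) * (t / (2 * z) + ln (2 * z))).
  { apply Rmult_le_compat_l; [lra |]. apply ln_le_linear; lra. }
  assert (H2 : (z - 1) * (t / (2 * z)) <= t / 2).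
  { replace ((z - 1) * (t / (2 * z))) with (t / 2 - t / (2 * z)) by (field; lra).
    assert (0 < t / (2 * z)) by (apply Rdiv_lt_0_compat; lra). lra. }
  destruct (Rle_lt_or_eq_dec ((z - 1) * ln t + - t)
     ((z - 1) * ln (2 * z) + - t / 2)) as [H3 | H3]; [lra | |].
  - left; apply exp_increasing; auto.
  - right; rewrite H3; auto.
Qed.

Lemma exp_half_integral (a b : R) :
  a < b ->
  is_RInt (fun t => exp (- t / 2)) a b (2 * exp (- a / 2) - 2 * exp (- b / 2)).
Proof.
  intros Hab.
  replace (2 * exp (- a / 2) - 2 * exp (- b / 2))
    with (minus (- 2 * exp (- b / 2)) (- 2 * exp (- a / 2)))
    by (unfold minus, plus, opp; simpl; ring).
  apply (is_RInt_derive (fun t => - 2 * exp (- t / 2))).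
  - intros t _. auto_derive; auto.  eq_in R. unfold Rdiv. field.
  - intros t _. apply (ex_derive_continuous (V := R_NormedModule)).
    auto_derive; auto.
Qed.

Lemma Gamma_integral (z : R) :
  1 <= z ->
  0 < Gamma z /\
  is_RInt_gen (fun t => Rpower t (z - 1) * exp (- t))
    (at_right 0) (Rbar_locally p_infty) (Gamma z).
Proof.
  intros Hz.
  destruct (gamma_integrand_le z Hz) as (K & HK & Hle).
  destruct (is_RInt_gen_pos (fun t => Rpower t (z - 1) * exp (- t)) (K * 2))
    as (L & HL & Hb).
  - intros t Ht. now apply gamma_integrand_continuous.
  - intros t _. left. apply gamma_integrand_pos.
  - intros a b Ha Hab.
    assert (HI : is_RInt (fun t => K * exp (- t / 2)) a b
                   (K * (2 * exp (- a / 2) - 2 * exp (- b / 2)))).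
    { apply (is_RInt_scal (fun t => exp (- t / 2)) a b K).
      now apply exp_half_integral. }
    apply Rle_trans with (RInt (fun t => K * exp (- t / 2)) a b).
    + apply RInt_le; [lra | | eexists; exact HI | ].
      * apply (ex_RInt_continuous (V := R_CompleteNormedModule)).
        intros t Ht. apply gamma_integrand_continuous.
        rewrite Rmin_left in Ht by lra. lra.
      * intros t Ht. apply Hle; lra.
    + rewrite (is_RInt_unique _ _ _ _ HI).
      apply Rmult_le_compat_l; [lra |].
      generalize (exp_pos (- b / 2)). intros.
      assert (exp (- a / 2) < exp 0) by (apply exp_increasing; lra).
      rewrite exp_0 in *. lra.
  - assert (HG : Gamma z = L) by (apply is_RInt_gen_unique; exact HL).
    rewrite HG. split; auto.
    apply Rlt_le_trans with (RInt (fun t => Rpower t (z - 1) * exp (- t)) 1 2);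
      [| apply Hb; lra].
    apply RInt_gt_0; [lra | |].
    + intros; apply gamma_integrand_pos.
    + intros; apply gamma_integrand_continuous; lra.
Qed.

Lemma Gamma_pos (z : R) : 1 <= z -> 0 < Gamma z.
Proof. intros Hz. apply (Gamma_integral z Hz). Qed.

(** Integration by parts: [F = - t ^ z * exp (- t)] is a primitive of the
    difference of the two integrands, and it vanishes at both ends. *)
Lemma Gamma_succ (z : R) : 1 <= z -> Gamma (z + 1) = z * Gamma z.
Proof.
  intros Hz.
  destruct (Gamma_integral z Hz) as [_ H1].
  destruct (Gamma_integral (z + 1)) as [_ H2]; [lra |].
  set (F := fun t => - (Rpower t (z + 1 - 1) * exp (- t))).
  assert (HD : forall t, 0 < t ->
    is_derive F t (minus (Rpower t (z + 1 - 1) * exp (- t))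
                 (scal z (Rpower t (z - 1) * exp (- t))))).
  { intros t Ht. unfold F, Rpower. auto_derive; auto.
    unfold minus, plus, opp, scal; simpl; unfold mult; simpl.
    replace (exp ((z - 1) * ln t)) with (exp ((z + 1 - 1) * ln t) / t).
    2:{ replace ((z - 1) * ln t) with ((z + 1 - 1) * ln t + - ln t) by ring.
        now rewrite exp_plus, exp_Ropp, exp_ln. } eq_in R. field. lra. }
  pose proof (is_RInt_gen_minus _ _ _ _ H2 (is_RInt_gen_scal _ z _ H1)) as H3.
  assert (Hz1 : z + 1 - 1 = z) by ring.
  assert (L0 : forall eps, 0 < eps ->
     at_right 0 (fun a => 0 < a < 1 /\ Rabs (F a) < eps)).
  { intros eps He. assert (Hm : 0 < Rmin 1 eps) by (apply Rmin_pos; lra).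
    exists (mkposreal _ Hm). intros a Ha Hpos.
    apply Rabs_def2 in Ha. unfold minus, plus, opp in Ha; simpl in Ha.
    generalize (Rmin_l 1 eps) (Rmin_r 1 eps); intros M1 M2.
    split; [lra |]. unfold F. rewrite Rabs_Ropp, Hz1.
    rewrite Rabs_pos_eq by
      (left; apply Rmult_lt_0_compat; apply exp_pos).
    assert (exp (- a) < 1) by (rewrite <- exp_0; apply exp_increasing; lra).
    assert (Rpower a z <= a).
    { unfold Rpower. rewrite <- (exp_ln a) at 2 by auto.
      assert (Hln : ln a < 0) by (rewrite <- ln_1; apply ln_increasing; lra).
      destruct (Req_dec z 1) as [-> | Hne]; [rewrite Rmult_1_l; lra |].
      left; apply exp_increasing. nra. }
    apply Rle_lt_trans with (a * 1); [| lra].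
    apply Rmult_le_compat; try lra; left; apply exp_pos. }
  assert (Li : forall eps, 0 < eps ->
     Rbar_locally p_infty (fun b => 1 < b /\ Rabs (F b) < eps)).
  { intros eps He. destruct (gamma_integrand_le (z + 1)) as (K & HK & Hle); [lra |].
    (* This is where [K * exp (- b / 2)] falls below [eps]. *)
    exists (Rmax 1 (- 2 * ln (eps / K))). intros b Hb.
    generalize (Rmax_l 1 (- 2 * ln (eps / K))) (Rmax_r 1 (- 2 * ln (eps / K))).
    intros M1 M2. split; [lra |].
    unfold F. rewrite Rabs_Ropp.
    rewrite Rabs_pos_eq by
      (left; apply Rmult_lt_0_compat; apply exp_pos).
    apply Rle_lt_trans with (K * exp (- b / 2)); [apply Hle; lra |].
    apply Rlt_le_trans with (K * (eps / K)); [| right; field; lra].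
    apply Rmult_lt_compat_l; auto.
    rewrite <- (exp_ln (eps / K)) by (apply Rdiv_lt_0_compat; lra).
    apply exp_increasing. lra. }
  assert (H4 : is_RInt_gen (fun y => minus (Rpower y (z + 1 - 1) * exp (- y))
      (scal z (Rpower y (z - 1) * exp (- y)))) (at_right 0)
      (Rbar_locally p_infty) 0).
  { apply filterlimi_locally. intros [eps He].
    assert (He2 : 0 < eps / 2) by lra.
    exists (fun a => 0 < a < 1 /\ Rabs (F a) < eps / 2)
           (fun b => 1 < b /\ Rabs (F b) < eps / 2); auto.
    intros a b [Ha HFa] [Hb HFb]. exists (minus (F b) (F a)). split.
    - simpl. apply (is_RInt_derive F).
      + intros t Ht. apply HD. rewrite Rmin_left in Ht by lra. lra.
      + intros t Ht. rewrite Rmin_left in Ht by lra.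
        apply (continuous_minus (V := R_NormedModule)).
        * apply gamma_integrand_continuous; lra.
        * apply (continuous_scal_r (V := R_NormedModule)).
          apply gamma_integrand_continuous; lra.
    - apply Rabs_def2 in HFa. apply Rabs_def2 in HFb.
      apply Rabs_def1; unfold minus, plus, opp; simpl; lra. }
  apply (is_RInt_gen_unique (V := R_CompleteNormedModule)) in H3.
  apply (is_RInt_gen_unique (V := R_CompleteNormedModule)) in H4.
  assert (H5 := eq_trans (eq_sym H3) H4).
  unfold minus, plus, opp, scal in H5; simpl in H5; unfold mult in H5; simpl in H5.
  lra.
Qed.

(** * Binomial coefficients with a real upper entry *)

Lemma gbinom_0 (r : R) : 0 <= r -> gbinom r 0 = 1.
Proof.
  intros Hr. unfold gbinom. simpl. rewrite Rplus_0_l.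
  assert (0 < Gamma (r + 1)) by (apply Gamma_pos; lra). field. lra.
Qed.

(** The functional equation of [Gamma], in the form that yields the differential
    equation of the binomial series. *)
Lemma gbinom_succ (r : R) (n : nat) :
  0 <= r -> gbinom r (S n) = (INR n + r + 1) / INR (S n) * gbinom r n.
Proof.
  intros Hr. unfold gbinom.
  replace (INR (S n) + r + 1) with (INR n + r + 1 + 1) by (rewrite S_INR; ring).
  rewrite Gamma_succ by (generalize (pos_INR n); lra).
  assert (0 < Gamma (r + 1)) by (apply Gamma_pos; lra).
  rewrite fact_simpl, mult_INR. field.
  repeat split; try apply INR_fact_neq_0; try lra.
  apply not_0_INR; lia.
Qed.

Lemma gbinom_pos (r : R) (n : nat) : 0 <= r -> 0 < gbinom r n.
Proof.
  intros Hr. unfold gbinom. generalize (pos_INR n); intros.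
  apply Rdiv_lt_0_compat; [apply Gamma_pos; lra |].
  apply Rmult_lt_0_compat; [apply Gamma_pos; lra | apply INR_fact_lt_0].
Qed.

Lemma gbinom_r0 (n : nat) : gbinom 0 n = 1.
Proof.
  induction n as [| n IH]; [apply gbinom_0; lra |].
  rewrite gbinom_succ, IH by lra. rewrite S_INR.
  generalize (pos_INR n); intros. field. lra.
Qed.

Lemma gbinom_CV_radius (r : R) : 0 <= r -> CV_radius (gbinom r) = 1.
Proof.
  intros Hr. rewrite <- Rinv_1.
  apply CV_radius_finite_DAlembert; [| lra |].
  - intros n. generalize (gbinom_pos r n Hr). lra.
  - apply is_lim_seq_ext with (fun n => 1 + r * / INR (S n)).
    + intros n. rewrite gbinom_succ by auto.
      generalize (gbinom_pos r n Hr) (pos_INR n); intros.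
      rewrite S_INR, Rabs_pos_eq.
      * field. lra.
      * apply Rlt_le, Rdiv_lt_0_compat; auto.
        apply Rmult_lt_0_compat; auto. apply Rdiv_lt_0_compat; lra.
    + replace (Finite 1) with (Finite (1 + r * 0)) by (f_equal; ring).
      apply is_lim_seq_plus'; [apply is_lim_seq_const |].
      apply (is_lim_seq_scal_l _ r 0).
      apply is_lim_seq_incr_1 with (u := fun n => / INR n).
      replace (Finite 0) with (Rbar_inv p_infty) by reflexivity.
      apply is_lim_seq_inv; [apply is_lim_seq_INR | discriminate].
Qed.

(** * Complex series *)

Lemma Re_sum_n (u : nat -> C) (n : nat) :
  Re (sum_n (G := C_AbelianMonoid) u n) = sum_n (fun k => Re (u k)) n.
Proof.
  induction n as [| n IH]; [now rewrite !sum_O |].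
  rewrite !sum_Sn, <- IH. reflexivity.
Qed.

Lemma Im_sum_n (u : nat -> C) (n : nat) :
  Im (sum_n (G := C_AbelianMonoid) u n) = sum_n (fun k => Im (u k)) n.
Proof.
  induction n as [| n IH]; [now rewrite !sum_O |].
  rewrite !sum_Sn, <- IH. reflexivity.
Qed.

Lemma is_series_C (u : nat -> C) (l : C) :
  is_series (fun n => Re (u n)) (Re l) ->
  is_series (fun n => Im (u n)) (Im l) ->
  is_series (V := C_NormedModule) u l.
Proof.
  intros HR HI.
  apply (filterlim_locally (U := C_UniformSpace)). intros eps.
  generalize (proj1 (filterlim_locally _ _) HR eps)
             (proj1 (filterlim_locally _ _) HI eps).
  intros [N1 H1] [N2 H2]. exists (max N1 N2). intros n Hn. split.
  - specialize (H1 n). rewrite <- Re_sum_n in H1. apply H1. lia.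
  - specialize (H2 n). rewrite <- Im_sum_n in H2. apply H2. lia.
Qed.

Lemma is_series_C_unique (u : nat -> C) (l l' : C) :
  is_series (V := C_NormedModule) u l ->
  is_series (V := C_NormedModule) u l' -> l = l'.
Proof.
  apply (filterlim_locally_unique (V := C_NormedModule)).
Qed.

Lemma CSeries_unique (u : nat -> C) (l : C) :
  is_series (V := C_NormedModule) u l -> CSeries u = l.
Proof.
  intros H. apply (iota_unique (V := C_CompleteNormedModule)); auto.
  intros l' H'. now apply is_series_C_unique with u.
Qed.

(** The triangle inequality for a dominated series; it carries the estimates on
    single terms over to the sums. *)
Lemma Cmod_series_le (u : nat -> C) (v : nat -> R) (l : C) (S : R) :
  (forall n, Cmod (u n) <= v n) ->
  is_series (V := C_NormedModule) u l -> is_series v S -> Cmod l <= S.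
Proof.
  intros Huv Hu Hv.
  assert (H := filterlim_comp _ _ _ _ _ _ _ _ Hu
                 (filterlim_norm (V := C_NormedModule) l)).
  change (is_lim_seq (fun n => Cmod (sum_n (G := C_AbelianMonoid) u n)) (Cmod l)) in H.
  refine (is_lim_seq_le _ _ (Cmod l) S _ H Hv).
  intros n. induction n as [| n IH].
  - rewrite !sum_O. apply Huv.
  - rewrite !sum_Sn. eapply Rle_trans; [apply Cmod_triangle |].
    apply Rplus_le_compat; auto.
Qed.

(** * Principal powers with real exponent *)

(** The arctangent form is smooth across the positive real axis, where the
    definition by [acos] changes sign; it is the form to differentiate. *)
Lemma Carg_right_half (z : C) : 0 < Re z -> Carg z = atan (Im z / Re z).
Proof.
  destruct z as [a b]. simpl. intros Ha. unfold Carg; simpl.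
  assert (Hc : a / Cmod (a, b) = cos (atan (b / a))).
  { rewrite cos_atan. unfold Cmod; simpl fst; simpl snd.
    replace (a ^ 2 + b ^ 2) with (a² * (1 + (b / a)²))
      by (unfold Rsqr; field; lra).
    rewrite sqrt_mult, sqrt_Rsqr;
      [| lra | apply Rle_0_sqr | generalize (Rle_0_sqr (b / a)); lra].
    field. split; [| lra].
    apply Rgt_not_eq, sqrt_lt_R0. generalize (Rle_0_sqr (b / a)); lra. }
  rewrite Hc. generalize (atan_bound (b / a)) PI_RGT_0. intros Hb Hpi.
  destruct (Rle_dec 0 b) as [H | H].
  - apply acos_cos. split; [| lra].
    rewrite <- atan_0. destruct H as [H | <-].
    + left. apply atan_increasing. apply Rdiv_lt_0_compat; auto.
    + right. f_equal. field. lra.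
  - rewrite <- cos_neg, acos_cos; [ring |].
    assert (atan (b / a) < 0).
    { rewrite <- atan_0. apply atan_increasing.
      unfold Rdiv. assert (0 < / a) by (apply Rinv_0_lt_compat; lra). nra. }
    lra.
Qed.

Lemma Cpower_polar (z : C) (s : R) :
  Cpower z (RtoC s) =
    (exp (s * ln (Cmod z)) * cos (s * Carg z),
     exp (s * ln (Cmod z)) * sin (s * Carg z)).
Proof.
  unfold Cpower, Cexp, Clog, Cmult, RtoC; simpl.
  replace (s * ln (Cmod z) - 0 * Carg z) with (s * ln (Cmod z)) by ring.
  replace (s * Carg z + 0 * ln (Cmod z)) with (s * Carg z) by ring.
  reflexivity.
Qed.

Lemma Cpower_neq_0 (z : C) (s : R) : Cpower z (RtoC s) <> RtoC 0.
Proof.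
  rewrite Cpower_polar. intros H.
  assert (Hc := f_equal fst H). assert (Hs := f_equal snd H). simpl in Hc, Hs.
  generalize (exp_pos (s * ln (Cmod z))) (sin2_cos2 (s * Carg z)).
  unfold Rsqr. intros He Hsc.
  apply Rmult_integral in Hc. apply Rmult_integral in Hs.
  destruct Hc as [Hc | Hc]; [lra |]. destruct Hs as [Hs | Hs]; [lra |].
  rewrite Hc, Hs in Hsc. lra.
Qed.

(** Homogeneity under positive scaling holds because the argument is
    unchanged; it reduces the base [a - x] to [1 - x / a]. *)
Lemma Cpower_scal (a : R) (z : C) (s : R) :
  0 < a -> 0 < Re z ->
  Cpower (RtoC a * z)%C (RtoC s) = (RtoC (Rpower a s) * Cpower z (RtoC s))%C.
Proof.
  intros Ha Hz. rewrite !Cpower_polar.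
  assert (Hr : Re (RtoC a * z)%C = a * Re z) by (destruct z; simpl; ring).
  assert (Hi : Im (RtoC a * z)%C = a * Im z) by (destruct z; simpl; ring).
  rewrite !Carg_right_half by (try rewrite Hr; auto; now apply Rmult_lt_0_compat).
  rewrite Hr, Hi.
  replace (a * Im z / (a * Re z)) with (Im z / Re z) by (field; lra).
  rewrite Cmod_mult, Cmod_R, Rabs_pos_eq by lra.
  rewrite ln_mult; auto.
  - rewrite Rmult_plus_distr_l, exp_plus. unfold Rpower, Cmult, RtoC; simpl.
    f_equal; ring.
  - apply Cmod_gt_0. intros ->. simpl in Hz. lra.
Qed.

Lemma Cpower_1 (s : R) : Cpower (RtoC 1) (RtoC s) = RtoC 1.
Proof.
  rewrite Cpower_polar, Carg_right_half by (simpl; lra).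
  rewrite Cmod_1, ln_1. simpl. unfold Rdiv; rewrite Rmult_0_l, atan_0, !Rmult_0_r.
  rewrite exp_0, cos_0, sin_0. unfold RtoC. f_equal; ring.
Qed.

Lemma Cpower_real (a s : R) :
  0 < a -> Cpower (RtoC a) (RtoC s) = RtoC (Rpower a s).
Proof.
  intros Ha. rewrite <- (Cmult_1_r (RtoC a)).
  rewrite Cpower_scal, Cpower_1 by (simpl; lra). apply Cmult_1_r.
Qed.

(** * The binomial series *)

Lemma ex_series_gbinom (r q : R) :
  0 <= r -> 0 <= q < 1 -> ex_series (fun n => gbinom r n * q ^ n).
Proof.
  intros Hr Hq. apply ex_series_ext with (fun n => Rabs (gbinom r n * q ^ n)).
  - intros n. apply Rabs_pos_eq, Rmult_le_pos; [| now apply pow_le].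
    left; now apply gbinom_pos.
  - apply CV_disk_inside. rewrite gbinom_CV_radius by auto.
    rewrite Rabs_pos_eq by lra. simpl; lra.
Qed.

(** The strict inequality makes the series differentiable on the closed segment
    [[0, 1]], including at [t = 1], where its value is the binomial series. *)
Lemma CV_radius_gt_1 (r q : R) (A : nat -> R) :
  0 <= r -> 0 <= q < 1 ->
  (forall n, Rabs (A n) <= gbinom r n * q ^ n) -> Rbar_lt 1 (CV_radius A).
Proof.
  intros Hr Hq HA.
  (* A radius strictly between 1 and [1 / q], also when [q = 0]. *)
  set (rho := 2 / (1 + q)).
  assert (Hrho : 1 < rho).
  { unfold rho. apply Rmult_lt_reg_r with (1 + q); [lra |].
    unfold Rdiv. rewrite Rmult_assoc, Rinv_l; lra. }
  assert (Hrq : 0 <= q * rho < 1).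
  { split; [apply Rmult_le_pos; lra |].
    unfold rho. apply Rmult_lt_reg_r with (1 + q); [lra |].
    replace (q * (2 / (1 + q)) * (1 + q)) with (2 * q) by (field; lra). lra. }
  apply Rbar_lt_le_trans with rho; [exact Hrho |].
  apply Rbar_not_lt_le. intros Hlt.
  replace rho with (Rabs rho) in Hlt by (apply Rabs_pos_eq; lra).
  apply (CV_disk_outside A rho Hlt).
  apply is_lim_seq_abs_0.
  apply is_lim_seq_le_le with (fun _ => 0) (fun n => gbinom r n * (q * rho) ^ n).
  - intros n. split; [apply Rabs_pos |].
    rewrite Rabs_mult, Rpow_mult_distr, <- Rmult_assoc.
    rewrite (Rabs_pos_eq (rho ^ n)) by (apply pow_le; lra).
    apply Rmult_le_compat_r; [apply pow_le; lra | apply HA].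
  - apply is_lim_seq_const.
  - now apply ex_series_lim_0, ex_series_gbinom.
Qed.

(** The Euler operator [t * d/dt + c] multiplies the [n]-th coefficient by
    [n + c]. *)
Lemma is_pseries_euler (a : nat -> R) (c t : R) :
  Rbar_lt (Rabs t) (CV_radius a) ->
  is_pseries (fun n => (INR n + c) * a n) t
    (t * PSeries (PS_derive a) t + c * PSeries a t).
Proof.
  intros Ht.
  apply is_pseries_ext with (PS_plus (PS_incr_1 (PS_derive a)) (PS_scal c a)).
  - intros [| n].
    + change (0 + c * a 0%nat = (0 + c) * a 0%nat). ring.
    + change (INR (S n) * a (S n) + c * a (S n) = (INR (S n) + c) * a (S n)). ring.
  - apply (is_pseries_plus (V := R_NormedModule)).
    + apply (is_pseries_incr_1 (V := R_NormedModule)), PSeries_correct. now apply ex_pseries_derive.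
    + apply (is_pseries_scal (V := R_NormedModule)); [apply Rmult_comm |].
      apply PSeries_correct. now apply CV_radius_inside.
Qed.

(** Write [y = u + i v].  The functions [PSeries A] and [PSeries B] are the real
    and imaginary parts of [phi t], the sum of the binomial series at [t * y].
    The coefficient recurrence gives [(1 - t y) phi' = s y phi], which says that
    [phi t * (1 - t y) ^ s] is constant; [P] and [Q] are the real and imaginary
    parts of this product, with the power written in polar form. *)
Section Ray.

Variables (r u v : R).
Hypothesis Hr : 0 <= r.
Hypothesis Huv : Cmod (u, v) < 1.

Let s := r + 1.
Let A (n : nat) : R := gbinom r n * Re ((u, v) ^ n)%C.
Let B (n : nat) : R := gbinom r n * Im ((u, v) ^ n)%C.

Lemma ray_radius_A : Rbar_lt 1 (CV_radius A).
Proof.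
  apply CV_radius_gt_1 with r (Cmod (u, v)); auto.
  - split; [apply Cmod_ge_0 | auto].
  - intros n. unfold A. rewrite Rabs_mult, Rabs_pos_eq
      by (left; now apply gbinom_pos).
    apply Rmult_le_compat_l; [left; now apply gbinom_pos |].
    rewrite <- Cmod_pow. apply re_le_Cmod.
Qed.

Lemma ray_radius_B : Rbar_lt 1 (CV_radius B).
Proof.
  apply CV_radius_gt_1 with r (Cmod (u, v)); auto.
  - split; [apply Cmod_ge_0 | auto].
  - intros n. unfold B. rewrite Rabs_mult, Rabs_pos_eq
      by (left; now apply gbinom_pos).
    apply Rmult_le_compat_l; [left; now apply gbinom_pos |].
    rewrite <- Cmod_pow.
    eapply Rle_trans; [| apply Rmax_Cmod]. apply Rmax_r.
Qed.

Lemma ray_rec_A (n : nat) :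
  PS_derive A n = (INR n + s) * (u * A n - v * B n).
Proof.
  unfold PS_derive, A, B. rewrite gbinom_succ by auto.
  change ((u, v) ^ S n)%C with ((u, v) * (u, v) ^ n)%C.
  destruct ((u, v) ^ n)%C as [c d]. simpl Re. simpl Im. unfold s.
  field. apply not_0_INR; lia.
Qed.

Lemma ray_rec_B (n : nat) :
  PS_derive B n = (INR n + s) * (u * B n + v * A n).
Proof.
  unfold PS_derive, A, B. rewrite gbinom_succ by auto.
  change ((u, v) ^ S n)%C with ((u, v) * (u, v) ^ n)%C.
  destruct ((u, v) ^ n)%C as [c d]. simpl Re. simpl Im. unfold s.
  field. apply not_0_INR; lia.
Qed.

(** By the recurrence, [phi'] has the coefficients of [y * (t * d/dt + s) phi];
    this is the real part of that equation. *)
Lemma ray_ode_A (t : R) :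
  Rbar_lt (Rabs t) (CV_radius A) -> Rbar_lt (Rabs t) (CV_radius B) ->
  PSeries (PS_derive A) t =
    u * (t * PSeries (PS_derive A) t + s * PSeries A t)
    - v * (t * PSeries (PS_derive B) t + s * PSeries B t).
Proof.
  intros HA HB. apply is_pseries_unique.
  apply is_pseries_ext with
    (PS_plus (PS_scal u (fun n => (INR n + s) * A n))
             (PS_scal (- v) (fun n => (INR n + s) * B n))).
  - intros n. rewrite ray_rec_A.
    unfold PS_plus, PS_scal, plus, scal; simpl; unfold mult; simpl. eq_in R; ring.
  - unfold Rminus. rewrite Ropp_mult_distr_l.
    apply (is_pseries_plus (V := R_NormedModule));
      apply (is_pseries_scal (V := R_NormedModule));
      try apply Rmult_comm; now apply is_pseries_euler.
Qed.

(** The imaginary part of the same equation. *)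
Lemma ray_ode_B (t : R) :
  Rbar_lt (Rabs t) (CV_radius A) -> Rbar_lt (Rabs t) (CV_radius B) ->
  PSeries (PS_derive B) t =
    u * (t * PSeries (PS_derive B) t + s * PSeries B t)
    + v * (t * PSeries (PS_derive A) t + s * PSeries A t).
Proof.
  intros HA HB. apply is_pseries_unique.
  apply is_pseries_ext with
    (PS_plus (PS_scal u (fun n => (INR n + s) * B n))
             (PS_scal v (fun n => (INR n + s) * A n))).
  - intros n. rewrite ray_rec_B.
    unfold PS_plus, PS_scal, plus, scal; simpl; unfold mult; simpl. eq_in R; ring.
  - apply (is_pseries_plus (V := R_NormedModule));
      apply (is_pseries_scal (V := R_NormedModule));
      try apply Rmult_comm; now apply is_pseries_euler.
Qed.

Let E (t : R) := exp (s * (/ 2 * ln ((1 - t * u) ^ 2 + (t * v) ^ 2))).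
Let theta (t : R) := s * atan (- (t * v) / (1 - t * u)).
Let P (t : R) :=
  E t * (PSeries A t * cos (theta t) - PSeries B t * sin (theta t)).
Let Q (t : R) :=
  E t * (PSeries A t * sin (theta t) + PSeries B t * cos (theta t)).

Lemma ray_derive (t : R) :
  0 <= t <= 1 -> is_derive P t 0 /\ is_derive Q t 0.
Proof.
  intros Ht.
  assert (HA : Rbar_lt (Rabs t) (CV_radius A)).
  { eapply Rbar_le_lt_trans; [| exact ray_radius_A].
    rewrite Rabs_pos_eq; simpl; lra. }
  assert (HB : Rbar_lt (Rabs t) (CV_radius B)).
  { eapply Rbar_le_lt_trans; [| exact ray_radius_B].
    rewrite Rabs_pos_eq; simpl; lra. }
  assert (Hc : 0 < 1 - t * u).
  { assert (Hu := re_le_Cmod (u, v)). simpl in Hu.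
    assert (Hu2 := Rle_abs u).
    assert (t * u <= t * Rabs u) by (apply Rmult_le_compat_l; lra).
    assert (t * Rabs u <= 1 * Rabs u)
      by (apply Rmult_le_compat_r; [apply Rabs_pos | lra]). lra. }
  assert (HD : 0 < (1 - t * u) ^ 2 + (t * v) ^ 2).
  { assert (0 < (1 - t * u) ^ 2) by now apply pow_lt.
    generalize (pow2_ge_0 (t * v)). lra. }
  assert (O1 := ray_ode_A t HA HB). assert (O2 := ray_ode_B t HA HB).
  assert (D1 := is_derive_unique _ _ _ (is_derive_PSeries _ _ HA)).
  assert (D2 := is_derive_unique _ _ _ (is_derive_PSeries _ _ HB)).
  assert (X1 := ex_derive_PSeries _ _ HA). assert (X2 := ex_derive_PSeries _ _ HB).
  rewrite <- D1, <- D2 in O1. rewrite <- D1, <- D2 in O2. clear D1 D2.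
  set (D := (1 - t * u) ^ 2 + (t * v) ^ 2) in *.
  (* The two equations form a linear system for the derivatives, with
     determinant [D = |1 - t y| ^ 2]. *)
  assert (S1 : Derive (PSeries A) t =
     s * ((u * (1 - t * u) - t * v ^ 2) * PSeries A t - v * PSeries B t) / D).
  { apply Rmult_eq_reg_r with D; [| lra].
    unfold Rdiv at 1. rewrite Rmult_assoc, Rinv_l, Rmult_1_r by lra.
    unfold D.
    set (dA := Derive (PSeries A) t) in *. set (dB := Derive (PSeries B) t) in *.
    set (a := PSeries A t) in *. set (b := PSeries B t) in *.
    assert (I1 : (1 - t * u) * dA + t * v * dB = s * (u * a - v * b)) by lra.
    assert (I2 : (1 - t * u) * dB - t * v * dA = s * (u * b + v * a)) by lra.
    replace (dA * ((1 - t * u) ^ 2 + (t * v) ^ 2)) with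
      ((1 - t * u) * ((1 - t * u) * dA + t * v * dB)
       - t * v * ((1 - t * u) * dB - t * v * dA)) by ring.
    rewrite I1, I2. ring. }
  assert (S2 : Derive (PSeries B) t =
     s * ((u * (1 - t * u) - t * v ^ 2) * PSeries B t + v * PSeries A t) / D).
  { apply Rmult_eq_reg_r with D; [| lra].
    unfold Rdiv at 1. rewrite Rmult_assoc, Rinv_l, Rmult_1_r by lra.
    unfold D.
    set (dA := Derive (PSeries A) t) in *. set (dB := Derive (PSeries B) t) in *.
    set (a := PSeries A t) in *. set (b := PSeries B t) in *.
    assert (I1 : (1 - t * u) * dA + t * v * dB = s * (u * a - v * b)) by lra.
    assert (I2 : (1 - t * u) * dB - t * v * dA = s * (u * b + v * a)) by lra.
    replace (dB * ((1 - t * u) ^ 2 + (t * v) ^ 2)) with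
      ((1 - t * u) * ((1 - t * u) * dB - t * v * dA)
       + t * v * ((1 - t * u) * dA + t * v * dB)) by ring.
    rewrite I1, I2. ring. }
  assert (dE : is_derive E t
     (- (s * (u * (1 - t * u) - t * v ^ 2) / D) * E t)).
  { unfold E at 1. auto_derive.
    - unfold D in HD. simpl in HD. simpl. lra.
    - match goal with |- context [exp ?a] => replace (exp a) with (E t)
        by (unfold E; do 4 f_equal; ring) end.
      replace ((1 + - (t * u)) * ((1 + - (t * u)) * 1) + t * v * (t * v * 1))
        with D by (unfold D; ring).
      eq_in R. field. lra. }
  assert (dT : is_derive theta t (- (s * v / D))).
  { unfold theta. auto_derive; [lra |].
    unfold D, Rsqr. field. unfold D in HD. simpl in HD. lra. }
  assert (XE : ex_derive E t) by (eexists; exact dE).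
  assert (XT : ex_derive theta t) by (eexists; exact dT).
  apply is_derive_unique in dE. apply is_derive_unique in dT.
  split.
  - unfold P. auto_derive;
      [exact (conj XE (conj X1 (conj XT (conj X2 (conj XT I))))) |].
    change (Derive (fun x => E x) t) with (Derive E t).
    change (Derive (fun x => theta x) t) with (Derive theta t).
    change (Derive (fun x => PSeries A x) t) with (Derive (PSeries A) t).
    change (Derive (fun x => PSeries B x) t) with (Derive (PSeries B) t).
    rewrite dE, dT, S1, S2. eq_in R. field. lra.
  - unfold Q. auto_derive;
      [exact (conj XE (conj X1 (conj XT (conj X2 (conj XT I))))) |].
    change (Derive (fun x => E x) t) with (Derive E t).
    change (Derive (fun x => theta x) t) with (Derive theta t).
    change (Derive (fun x => PSeries A x) t) with (Derive (PSeries A) t).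
    change (Derive (fun x => PSeries B x) t) with (Derive (PSeries B) t).
    rewrite dE, dT, S1, S2. eq_in R. field. lra.
Qed.

Lemma ray_const : P 1 = 1 /\ Q 1 = 0.
Proof.
  assert (H0 : P 0 = 1 /\ Q 0 = 0).
  { unfold P, Q, E, theta. rewrite !PSeries_0. unfold A, B. simpl.
    rewrite gbinom_0 by auto.
    replace (- (0 * v) / (1 - 0 * u)) with 0 by field.
    replace ((1 - 0 * u) * ((1 - 0 * u) * 1) + 0 * v * (0 * v * 1)) with 1 by ring.
    rewrite atan_0, ln_1, !Rmult_0_r, exp_0, cos_0, sin_0. split; ring. }
  destruct H0 as [HP0 HQ0].
  assert (HP : P 0 = P 1)
    by (apply (eq_is_derive (V := R_NormedModule)); [apply ray_derive | lra]).
  assert (HQ : Q 0 = Q 1)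
    by (apply (eq_is_derive (V := R_NormedModule)); [apply ray_derive | lra]).
  lra.
Qed.

(** [phi 1 * (1 - y) ^ s = phi 0 = 1]. *)
Lemma ray_binomial :
  is_series (V := C_NormedModule)
    (fun n => RtoC (gbinom r n) * (u, v) ^ n)%C
    (/ Cpower (RtoC 1 - (u, v)) (RtoC (r + 1)))%C.
Proof.
  assert (Hu : 0 < 1 - u).
  { assert (Hu := re_le_Cmod (u, v)). simpl in Hu.
    generalize (Rle_abs u). lra. }
  assert (HP : (PSeries A 1, PSeries B 1) =
    (/ Cpower (RtoC 1 - (u, v)) (RtoC (r + 1)))%C).
  { assert (Hm : ((PSeries A 1, PSeries B 1)
      * Cpower (RtoC 1 - (u, v)) (RtoC (r + 1)))%C = RtoC 1).
    { destruct ray_const as [HP HQ]. rewrite Cpower_polar, Carg_right_half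
        by (simpl; lra).
      replace (ln (Cmod (RtoC 1 - (u, v))%C))
        with (/ 2 * ln ((1 - 1 * u) ^ 2 + (1 * v) ^ 2)).
      - replace (Im (RtoC 1 - (u, v))%C / Re (RtoC 1 - (u, v))%C)
          with (- (1 * v) / (1 - 1 * u)) by (simpl; field; lra).
        change (r + 1) with s. fold (theta 1). fold (E 1). transitivity (P 1, Q 1); [| now rewrite HP, HQ].
        unfold P, Q, Cmult; simpl. f_equal; ring.
      - unfold Cmod; simpl fst; simpl snd.
        replace ((1 - 1 * u) ^ 2 + (1 * v) ^ 2)
          with ((1 + - u) ^ 2 + (0 + - v) ^ 2) by ring.
        assert (HD : 0 < (1 + - u) ^ 2 + (0 + - v) ^ 2).
        { assert (0 < (1 + - u) ^ 2) by (apply pow_lt; lra).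
          generalize (pow2_ge_0 (0 + - v)). lra. }
        set (D := (1 + - u) ^ 2 + (0 + - v) ^ 2) in *.
        rewrite <- (sqrt_sqrt D) at 1 by lra.
        rewrite ln_mult by now apply sqrt_lt_R0. field. }
    apply (f_equal (fun w => w * / Cpower (RtoC 1 - (u, v)) (RtoC (r + 1)))%C) in Hm.
    rewrite <- Cmult_assoc, Cinv_r, Cmult_1_r, Cmult_1_l in Hm; auto.
    apply Cpower_neq_0. }
  rewrite <- HP. apply is_series_C.
  - apply is_series_ext with (fun n => A n * 1 ^ n).
    + intros n. unfold A. rewrite pow1.
      destruct ((u, v) ^ n)%C as [c d]; simpl. eq_in R. ring.
    + apply is_pseries_R, PSeries_correct, CV_radius_inside.
      rewrite Rabs_R1. exact ray_radius_A.
  - apply is_series_ext with (fun n => B n * 1 ^ n).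
    + intros n. unfold B. rewrite pow1.
      destruct ((u, v) ^ n)%C as [c d]; simpl. eq_in R. ring.
    + apply is_pseries_R, PSeries_correct, CV_radius_inside.
      rewrite Rabs_R1. exact ray_radius_B.
Qed.

End Ray.

(** The case [a = 1] applied to [x / a], multiplied by [a ^ - (r + 1)]. *)
Lemma is_series_binomial (r a : R) (x : C) :
  0 <= r -> Cmod x < a ->
  is_series (V := C_NormedModule)
    (fun n => RtoC (gbinom r n) * x ^ n * RtoC (/ Rpower a (INR n + r + 1)))%C
    (/ Cpower (RtoC a - x) (RtoC (r + 1)))%C.
Proof.
  intros Hr Hx.
  assert (Ha : 0 < a) by (generalize (Cmod_ge_0 x); lra).
  assert (HaC : RtoC a <> RtoC 0) by (intros H; apply RtoC_inj in H; lra).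
  set (y := (x / RtoC a)%C).
  assert (Hy : Cmod y < 1).
  { unfold y. rewrite Cmod_div, Cmod_R, Rabs_pos_eq by (auto; lra).
    apply Rmult_lt_reg_r with a; auto. unfold Rdiv.
    rewrite Rmult_assoc, Rinv_l; lra. }
  assert (Hxy : x = (RtoC a * y)%C) by (unfold y; field; auto).
  assert (Hre : 0 < Re (RtoC 1 - y)%C).
  { assert (Hu := re_le_Cmod y). generalize (Rle_abs (Re y)).
    destruct y; simpl in *. lra. }
  assert (Hb : is_series (V := C_NormedModule)
    (fun n => RtoC (gbinom r n) * y ^ n)%C
    (/ Cpower (RtoC 1 - y) (RtoC (r + 1)))%C).
  { destruct y as [u v]. now apply ray_binomial. }
  apply (is_series_scal (V := C_NormedModule) (RtoC (/ Rpower a (r + 1)))) in Hb.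
  replace (/ Cpower (RtoC a - x) (RtoC (r + 1)))%C with
    (scal (V := C_NormedModule) (RtoC (/ Rpower a (r + 1)))
      (/ Cpower (RtoC 1 - y) (RtoC (r + 1)))%C).
  - revert Hb. apply is_series_ext. intros n.
    change (RtoC (/ Rpower a (r + 1)) * (RtoC (gbinom r n) * y ^ n) =
      RtoC (gbinom r n) * x ^ n * RtoC (/ Rpower a (INR n + r + 1)))%C.
    rewrite Hxy, Cpow_mult_l, <- RtoC_pow, Rplus_assoc, (Rpower_plus (INR n)), Rpower_pow
      by auto.
    assert (Hp := exp_pos ((r + 1) * ln a)). fold (Rpower a (r + 1)) in Hp.
    assert (Hp2 := pow_lt a n Ha).
    rewrite Rinv_mult, RtoC_mult, (RtoC_inv (a ^ n)) by lra.
    field. intros H; apply RtoC_inj in H; lra.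
  - change (RtoC (/ Rpower a (r + 1)) * / Cpower (RtoC 1 - y) (RtoC (r + 1))
      = / Cpower (RtoC a - x) (RtoC (r + 1)))%C.
    replace (RtoC a - x)%C with (RtoC a * (RtoC 1 - y))%C
      by (rewrite Hxy; ring).
    assert (Hp := exp_pos ((r + 1) * ln a)). fold (Rpower a (r + 1)) in Hp.
    rewrite Cpower_scal, RtoC_inv by (auto; lra).
    field. split; [apply Cpower_neq_0 |].
    intros H; apply RtoC_inj in H; lra.
Qed.

(** * Alternating series and the eta function *)

Lemma alternating_sum (u : nat -> R) :
  (forall n, u (S n) <= u n) -> is_lim_seq u 0 ->
  exists l, is_series (fun m => (-1) ^ m * u m) l /\ 0 <= l <= u 0%nat.
Proof.
  intros Hd Hl.
  apply is_lim_seq_Reals in Hl.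
  destruct (alternated_series u Hd Hl) as [l Hs].
  exists l. split; [now apply is_series_Reals |].
  assert (H := alternated_series_ineq u l 0 Hd Hl Hs).
  unfold tg_alt in H. simpl in H. specialize (Hd 0%nat). lra.
Qed.

(** Up to sign, the remainder is itself an alternating sum, starting with the
    first omitted term, and such a sum lies between 0 and its first term. *)
Lemma alternating_remainder (u : nat -> R) :
  (forall n, u (S n) <= u n) -> is_lim_seq u 0 ->
  exists l, is_series (fun m => (-1) ^ m * u m) l /\
    forall N, Rabs (l - sum_n (fun m => (-1) ^ m * u m) N) <= u (S N).
Proof.
  intros Hd Hl.
  destruct (alternating_sum u Hd Hl) as (l & Hs & _).
  exists l. split; auto. intros N.
  destruct (alternating_sum (fun k => u (S N + k)%nat)) as (l' & Hs' & Hb).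
  - intros n. rewrite Nat.add_succ_r. apply Hd.
  - apply is_lim_seq_ext with (fun k => u (k + S N)%nat).
    + intros n. f_equal. lia.
    + now apply is_lim_seq_incr_n.
  - assert (H : l - sum_n (fun m => (-1) ^ m * u m) N = (-1) ^ S N * l').
    { transitivity (Series (fun k => (-1) ^ (S N + k) * u (S N + k)%nat)).
      - symmetry. apply is_series_unique.
        apply (is_series_incr_n (V := R_NormedModule)
                 (fun m => (-1) ^ m * u m) (S N)); [lia |].
        simpl pred.
        assert (Hadd : forall a b : R, plus (a - b) b = a)
          by (intros; unfold plus; simpl; eq_in R; ring).
        rewrite Hadd. exact Hs.
      - apply is_series_unique.
        apply is_series_ext with
          (fun k => scal ((-1) ^ S N) ((-1) ^ k * u (S N + k)%nat)).
        + intros k. unfold scal; simpl; unfold mult; simpl.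
          change ((-1) ^ S N * ((-1) ^ k * u (S N + k)%nat)
            = (-1) ^ (S N + k) * u (S N + k)%nat).
          rewrite pow_add. ring.
        + apply (is_series_scal (V := R_NormedModule)). exact Hs'. }
    rewrite H, Rabs_mult, pow_1_abs, Rmult_1_l, Rabs_pos_eq by lra.
    rewrite Nat.add_0_r in Hb. lra.
Qed.

(** One factor [1 / b] is kept for the limit in the truncation order, and [n]
    factors are weakened to [1 / 2] to get a convergent series in [n]. *)
Lemma Rinv_Rpower_le (b s : R) (n : nat) :
  2 <= b -> 1 <= s -> / Rpower b (INR n + s) <= / 2 ^ n * / b.
Proof.
  intros Hb Hs. rewrite <- Rinv_mult.
  assert (0 < 2 ^ n) by (apply pow_lt; lra).
  apply Rinv_le_contravar; [apply Rmult_lt_0_compat; lra |].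
  rewrite Rpower_plus, Rpower_pow by lra.
  apply Rmult_le_compat; try lra.
  - apply pow_incr; lra.
  - rewrite <- (Rpower_1 b) at 1 by lra. apply Rle_Rpower; lra.
Qed.

Lemma sum_n_split_first (a : nat -> R) (n : nat) :
  sum_n a (S n) = a 0%nat + sum_n (fun k => a (S k)) n.
Proof.
  induction n as [| n IH].
  - rewrite sum_Sn, !sum_O. reflexivity.
  - rewrite sum_Sn, IH, sum_Sn. unfold plus; simpl. ring.
Qed.

Lemma one_minus_euler_eta (s : R) :
  1 <= s ->
  exists d : R,
    (RtoC 1 - euler_eta (RtoC s))%C = RtoC d /\
    Rabs d <= / Rpower 2 s /\
    forall N,
      Rabs (d - sum_n (fun m => (-1) ^ m * / Rpower (INR m + 2) s) N)
      <= / Rpower (INR N + 3) s.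
Proof.
  intros Hs.
  assert (Hpos : forall b, 0 < Rpower b s) by (intros; apply exp_pos).
  destruct (alternating_remainder (fun m => / Rpower (INR m + 1) s))
    as (l & Hl & Hr).
  - intros n. apply Rinv_le_contravar; auto.
    rewrite S_INR. generalize (pos_INR n); intros.
    apply Rle_Rpower_l; lra.
  - apply is_lim_seq_le_le with (fun _ => 0) (fun n => / INR (S n)).
    + intros n. split; [left; now apply Rinv_0_lt_compat |].
      rewrite S_INR. generalize (pos_INR n); intros.
      apply Rinv_le_contravar; [lra |].
      rewrite <- (Rpower_1 (INR n + 1)) at 1 by lra. apply Rle_Rpower; lra.
    + apply is_lim_seq_const.
    + apply is_lim_seq_incr_1 with (u := fun n => / INR n).
      replace (Finite 0) with (Rbar_inv p_infty) by reflexivity.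
      apply is_lim_seq_inv; [apply is_lim_seq_INR | discriminate].
  - assert (H0 : (-1) ^ 0 * / Rpower (INR 0 + 1) s = 1).
    { simpl. rewrite Rplus_0_l. unfold Rpower. rewrite ln_1, Rmult_0_r, exp_0.
      field. }
    (* [1 - l] is minus the remainder after the term of index 0, so the
       truncation at [N] here is the one at [S N] for [l]. *)
    exists (1 - l). split; [| split].
    + rewrite RtoC_minus. f_equal. f_equal.
      apply CSeries_unique. apply is_series_C.
      * refine (is_series_ext _ _ _ _ Hl). intros n.
        rewrite <- RtoC_plus, Cpower_real by (generalize (pos_INR n); lra).
        rewrite <- RtoC_div by (apply Rgt_not_eq, Hpos). reflexivity.
      * replace (Im (RtoC l)) with (0 * 0) by (simpl; ring).
        apply is_series_ext with (fun n => scal 0 ((-1) ^ n * / Rpower (INR n + 1) s)).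
        -- intros n.
           rewrite <- RtoC_plus, Cpower_real by (generalize (pos_INR n); lra).
           rewrite <- RtoC_div by (apply Rgt_not_eq, Hpos). apply Rmult_0_l.
        -- replace (0 * 0) with (scal 0 l) by (change (0 * l = 0 * 0); ring).
           apply (is_series_scal (V := R_NormedModule)). exact Hl.
    + specialize (Hr 0%nat). rewrite sum_O, H0 in Hr.
      rewrite Rabs_minus_sym. simpl INR in Hr.
      replace 2 with (1 + 1) by ring. exact Hr.
    + intros N. specialize (Hr (S N)). rewrite sum_n_split_first, H0 in Hr.
      rewrite !S_INR in Hr.
      replace (INR N + 1 + 1 + 1) with (INR N + 3) in Hr by ring.
      rewrite Rabs_minus_sym.
      replace (sum_n (fun m => (-1) ^ m * / Rpower (INR m + 2) s) N - (1 - l))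
        with (l - (1 + sum_n (fun k => (-1) ^ S k * / Rpower (INR (S k) + 1) s) N));
        auto.
      replace (sum_n (fun k => (-1) ^ S k * / Rpower (INR (S k) + 1) s) N)
        with (- sum_n (fun m => (-1) ^ m * / Rpower (INR m + 2) s) N); [ring |].
      clear. induction N as [| N IH].
      * rewrite !sum_O. simpl INR.
        replace (1 + 1) with (0 + 2) by ring. simpl. ring.
      * rewrite !sum_Sn, <- IH. unfold plus; cbn -[INR pow].
        rewrite (S_INR (S N)). replace (INR (S N) + 1 + 1) with (INR (S N) + 2) by ring.
        change ((-1) ^ S (S N)) with (-1 * (-1) ^ S N). ring.
Qed.

(** * The case p = 0 *)

(** The finite sums over [m] are exchanged with the sum over [n] term by term,
    and the remainders, bounded by the terms of a series in [n] with sum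
    [K / (N + 3)], disappear in the limit. *)
Lemma eta_series (r : R) (x : C) :
  0 <= r -> Cmod x < 2 ->
  is_series (V := C_NormedModule)
    (fun n => RtoC (gbinom r n) * (RtoC 1 - euler_eta (RtoC (INR n + r + 1)))
              * x ^ n)%C
    (eta (RtoC (r + 1)) (RtoC 2 - x)).
Proof.
  intros Hr Hx.
  set (a := fun n => (RtoC (gbinom r n)
    * (RtoC 1 - euler_eta (RtoC (INR n + r + 1))) * x ^ n)%C).
  set (d := fun N n => sum_n (fun m =>
    (-1) ^ m * / Rpower (INR m + 2) (INR n + r + 1)) N).
  set (F := fun m => (RtoC ((-1) ^ m) /
    Cpower (RtoC (INR m) + (RtoC 2 - x)) (RtoC (r + 1)))%C).
  set (q := Cmod x / 2).
  assert (Hq : 0 <= q < 1) by (unfold q; generalize (Cmod_ge_0 x); lra).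
  assert (Hqx : forall n, Cmod x ^ n * / 2 ^ n = q ^ n).
  { intros n. unfold q, Rdiv. now rewrite Rpow_mult_distr, pow_inv. }
  assert (Hs : forall n, 1 <= INR n + r + 1) by (intros n; generalize (pos_INR n); lra).
  destruct (ex_series_gbinom r q Hr Hq) as [K HK].
  assert (Ha : ex_series (V := C_CompleteNormedModule) a).
  { apply ex_series_le with (fun n => gbinom r n * q ^ n);
      [| eexists; exact HK].
    intros n. change (Cmod (a n) <= gbinom r n * q ^ n).
    destruct (one_minus_euler_eta _ (Hs n)) as (dn & Hd & Hb & _).
    unfold a. rewrite Hd, !Cmod_mult, !Cmod_R, Cmod_pow.
    rewrite Rabs_pos_eq by (left; now apply gbinom_pos).
    rewrite Rmult_assoc. apply Rmult_le_compat_l; [left; now apply gbinom_pos |].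
    rewrite <- Hqx, Rmult_comm.
    apply Rmult_le_compat_l; [apply pow_le, Cmod_ge_0 |].
    eapply Rle_trans; [exact Hb |].
    rewrite Rplus_assoc. eapply Rle_trans; [apply Rinv_Rpower_le; lra |].
    assert (0 < / 2 ^ n) by (apply Rinv_0_lt_compat, pow_lt; lra). lra. }
  destruct Ha as [T HT].
  (* Exchange of the sum over [m <= N] with the sum over [n]. *)
  assert (Hpart : forall N, is_series (V := C_NormedModule)
    (fun n => RtoC (gbinom r n) * RtoC (d N n) * x ^ n)%C
    (sum_n (G := C_AbelianMonoid) F N)).
  { assert (HF : forall m, is_series (V := C_NormedModule)
      (fun n => RtoC (gbinom r n)
         * RtoC ((-1) ^ m * / Rpower (INR m + 2) (INR n + r + 1)) * x ^ n)%C (F m)).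
    { intros m.
      assert (Hb : Cmod x < INR m + 2) by (generalize (pos_INR m); lra).
      generalize (is_series_scal (V := C_NormedModule) (RtoC ((-1) ^ m)) _ _
                    (is_series_binomial r (INR m + 2) x Hr Hb)).
      unfold F. replace (RtoC (INR m) + (RtoC 2 - x))%C
        with (RtoC (INR m + 2) - x)%C by (rewrite RtoC_plus; ring).
      apply is_series_ext. intros n. rewrite RtoC_mult.
      unfold scal; simpl; unfold mult; simpl.
      eq_in C. ring. }
    induction N as [| N IH].
    - unfold d. rewrite sum_O. generalize (HF 0%nat). apply is_series_ext.
      intros n. now rewrite sum_O.
    - rewrite sum_Sn.
      generalize (is_series_plus (V := C_NormedModule) _ _ _ _ IH (HF (S N))).
      apply is_series_ext. intros n. unfold d. rewrite (sum_Sn _ N).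
      unfold plus at 2; simpl AbelianMonoid.plus. rewrite RtoC_plus.
      unfold plus; simpl.
      eq_in C. ring. }
  assert (Hrem : forall N,
    Cmod (sum_n (G := C_AbelianMonoid) F N - T) <= K * / (INR N + 3)).
  { intros N. rewrite <- Cmod_opp.
    assert (H3 : 3 <= INR N + 3) by (generalize (pos_INR N); lra).
    replace (- (sum_n (G := C_AbelianMonoid) F N - T))%C
      with (plus T (opp (sum_n (G := C_AbelianMonoid) F N)) : C)
      by (change (T + - sum_n (G := C_AbelianMonoid) F N
                = - (sum_n (G := C_AbelianMonoid) F N - T))%C; ring).
    refine (Cmod_series_le _ (fun n => gbinom r n * q ^ n * / (INR N + 3)) _ _ _
      (is_series_minus (V := C_NormedModule) _ _ _ _ HT (Hpart N)) _).
    - intros n.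
      destruct (one_minus_euler_eta _ (Hs n)) as (dn & Hd & _ & Hb).
      specialize (Hb N). fold (d N n) in Hb.
      change (Cmod (a n - RtoC (gbinom r n) * RtoC (d N n) * x ^ n)%C
        <= gbinom r n * q ^ n * / (INR N + 3)).
      replace (a n - RtoC (gbinom r n) * RtoC (d N n) * x ^ n)%C
        with (RtoC (gbinom r n) * RtoC (dn - d N n) * x ^ n)%C
        by (unfold a; rewrite Hd, RtoC_minus; ring).
      rewrite !Cmod_mult, !Cmod_R, Cmod_pow.
      rewrite (Rabs_pos_eq (gbinom r n)) by (left; now apply gbinom_pos).
      rewrite !Rmult_assoc. apply Rmult_le_compat_l; [left; now apply gbinom_pos |].
      rewrite <- Hqx, Rmult_comm, Rmult_assoc.
      apply Rmult_le_compat_l; [apply pow_le, Cmod_ge_0 |].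
      eapply Rle_trans; [exact Hb |].
      rewrite Rplus_assoc. apply Rinv_Rpower_le; lra.
    - now apply is_series_scal_r. }
  assert (HFT : is_series (V := C_NormedModule) F T).
  { apply (filterlim_locally (U := C_UniformSpace)). intros eps.
    assert (Hlim : is_lim_seq (fun N => K * / INR N) 0).
    { replace (Finite 0) with (Finite (K * 0)) by (f_equal; ring).
      apply (is_lim_seq_scal_l _ K 0).
      replace (Finite 0) with (Rbar_inv p_infty) by reflexivity.
      apply is_lim_seq_inv; [apply is_lim_seq_INR | discriminate]. }
    apply is_lim_seq_spec in Hlim. destruct (Hlim eps) as [N0 HN0].
    exists N0. intros N HN. apply C_NormedModule_mixin_compat1.
    eapply Rle_lt_trans; [apply Hrem |].
    specialize (HN0 (N + 3)%nat). rewrite plus_INR in HN0. simpl (INR 3) in HN0.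
    replace (1 + 1 + 1) with 3 in HN0 by ring.
    eapply Rle_lt_trans; [apply Rle_abs |].
    rewrite Rminus_0_r in HN0. apply HN0. lia. }
  change (eta (RtoC (r + 1)) (RtoC 2 - x)) with (CSeries F).
  rewrite (CSeries_unique _ _ HFT). exact HT.
Qed.

(** * Powers as combinations of falling factorials *)

Fixpoint falling (y : R) (j : nat) : R :=
  match j with
  | O => 1
  | S j' => falling y j' * (y - INR j')
  end.

Lemma stirling2_gt (p j : nat) : (p < j)%nat -> stirling2 p j = 0%nat.
Proof.
  revert j. induction p as [| p IH]; intros [| j] Hj; try lia; [reflexivity |].
  simpl. rewrite !IH by lia. lia.
Qed.

(** Induction on [p]: multiplying [falling y j] by [y] gives
    [falling y (S j) + j * falling y j], which is the recurrence of the Stirling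
    numbers. *)
Lemma pow_stirling2 (y : R) (p : nat) :
  y ^ p = sum_n (fun j => INR (stirling2 p j) * falling y j) p.
Proof.
  induction p as [| p IH].
  - rewrite sum_O. simpl. ring.
  - rewrite sum_n_split_first.
    transitivity (sum_n (fun j => INR j * (INR (stirling2 p j) * falling y j)) p
      + sum_n (fun j => INR (stirling2 p j) * falling y (S j)) p).
    + change (y ^ S p) with (y * y ^ p). rewrite IH.
      transitivity (sum_n (fun j => y * (INR (stirling2 p j) * falling y j)) p).
      * symmetry. apply (sum_n_mult_l (K := R_Ring)).
      * transitivity (sum_n (fun j => plus (INR j * (INR (stirling2 p j) * falling y j))
          (INR (stirling2 p j) * falling y (S j))) p).
        -- apply sum_n_ext. intros j. unfold plus; simpl. eq_in R. ring.
        -- apply (sum_n_plus (G := R_AbelianMonoid)).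
    + transitivity (sum_n (fun j => plus
          (INR (S j) * (INR (stirling2 p (S j)) * falling y (S j)))
          (INR (stirling2 p j) * falling y (S j))) p).
      * rewrite sum_n_plus. unfold plus; cbn -[sum_n INR falling]. f_equal.
        assert (H := sum_n_split_first
          (fun j => INR j * (INR (stirling2 p j) * falling y j)) p).
        rewrite sum_Sn in H. rewrite (stirling2_gt p (S p)) in H by lia.
        unfold plus in H; cbn -[sum_n INR falling] in H.
        simpl (INR 0) in H. lra.
      * simpl (stirling2 (S p) 0). simpl (INR 0). rewrite Rmult_0_l, Rplus_0_l.
        apply sum_n_ext. intros j.
        change (stirling2 (S p) (S j))
          with (S j * stirling2 p (S j) + stirling2 p j)%nat.
        rewrite plus_INR, mult_INR. unfold plus; cbn -[INR falling]. eq_in R. ring.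
Qed.

Lemma falling_lt (n j : nat) : (n < j)%nat -> falling (INR n) j = 0.
Proof.
  induction j as [| j IH]; [lia |]. intros Hj. simpl.
  destruct (Nat.eq_dec n j) as [-> | Hne]; [ring |].
  rewrite IH by lia. ring.
Qed.

(** Without subtraction on natural numbers: the falling factorial is
    [n! / (n - j)!], with [n = j + k]. *)
Lemma falling_fact (j k : nat) :
  falling (INR (j + k)) j * INR (fact k) = INR (fact (j + k)).
Proof.
  revert k. induction j as [| j IH]; intros k; [simpl; ring |].
  replace (S j + k)%nat with (j + S k)%nat by lia.
  rewrite <- IH, fact_simpl, mult_INR. cbn -[INR fact].
  rewrite plus_INR. ring.
Qed.

Lemma gbinom_falling (r : R) (j k : nat) :
  0 <= r ->
  gbinom r (j + k) * falling (INR (j + k)) j =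
    / Gamma (r + 1) * Gamma (r + INR j + 1) * gbinom (r + INR j) k.
Proof.
  intros Hr. unfold gbinom.
  rewrite <- falling_fact, plus_INR.
  replace (INR j + INR k + r + 1) with (INR k + (r + INR j) + 1) by ring.
  generalize (pos_INR j); intros Hj.
  assert (0 < Gamma (r + 1)) by (apply Gamma_pos; lra).
  assert (0 < Gamma (r + INR j + 1)) by (apply Gamma_pos; lra).
  assert (Hf := INR_fact_neq_0 (j + k)). rewrite <- falling_fact, plus_INR in Hf.
  assert (Hk := INR_fact_neq_0 k).
  field. repeat split; try lra; auto.
  intros Hz. rewrite Hz in Hf. lra.
Qed.

(** The first [j] terms vanish, and after the shift by [j] the series is that
    of [eta_series] for [r + j]. *)
Lemma falling_eta_series (r : R) (x : C) (j : nat) :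
  0 <= r -> Cmod x < 2 ->
  is_series (V := C_NormedModule)
    (fun n => RtoC (gbinom r n * falling (INR n) j)
              * (RtoC 1 - euler_eta (RtoC (INR n + r + 1))) * x ^ n)%C
    (RtoC (/ Gamma (r + 1)) * (RtoC (Gamma (r + INR j + 1))
       * eta (RtoC (r + INR j + 1)) (RtoC 2 - x) * x ^ j))%C.
Proof.
  intros Hr Hx.
  set (f := fun n => (RtoC (gbinom r n * falling (INR n) j)
    * (RtoC 1 - euler_eta (RtoC (INR n + r + 1))) * x ^ n)%C).
  set (l := (RtoC (/ Gamma (r + 1)) * (RtoC (Gamma (r + INR j + 1))
       * eta (RtoC (r + INR j + 1)) (RtoC 2 - x) * x ^ j))%C).
  assert (Hrj : 0 <= r + INR j) by (generalize (pos_INR j); lra).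
  assert (Htail : is_series (V := C_NormedModule) (fun k => f (j + k)%nat) l).
  { generalize (is_series_scal (V := C_NormedModule)
      (RtoC (/ Gamma (r + 1)) * RtoC (Gamma (r + INR j + 1)) * x ^ j)%C _ _
      (eta_series (r + INR j) x Hrj Hx)).
    replace l with (scal (V := C_NormedModule)
      (RtoC (/ Gamma (r + 1)) * RtoC (Gamma (r + INR j + 1)) * x ^ j)%C
      (eta (RtoC (r + INR j + 1)) (RtoC 2 - x))).
    - apply is_series_ext. intros k. unfold f.
      rewrite gbinom_falling by auto. rewrite plus_INR, Cpow_add_r, !RtoC_mult.
      replace (INR j + INR k + r + 1) with (INR k + (r + INR j) + 1) by ring.
      change (@eq C (RtoC (/ Gamma (r + 1)) * RtoC (Gamma (r + INR j + 1)) * x ^ j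
        * (RtoC (gbinom (r + INR j) k)
           * (RtoC 1 - euler_eta (RtoC (INR k + (r + INR j) + 1))) * x ^ k))%C
        (RtoC (/ Gamma (r + 1)) * RtoC (Gamma (r + INR j + 1))
           * RtoC (gbinom (r + INR j) k)
           * (RtoC 1 - euler_eta (RtoC (INR k + (r + INR j) + 1)))
           * (x ^ j * x ^ k))%C).
      ring.
    - unfold l.
      change (@eq C (RtoC (/ Gamma (r + 1)) * RtoC (Gamma (r + INR j + 1)) * x ^ j
         * eta (RtoC (r + INR j + 1)) (RtoC 2 - x))%C
        (RtoC (/ Gamma (r + 1)) * (RtoC (Gamma (r + INR j + 1))
       * eta (RtoC (r + INR j + 1)) (RtoC 2 - x) * x ^ j))%C).
      ring. }
  destruct j as [| j]; [exact Htail |].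
  apply (is_series_decr_n (V := C_NormedModule) f (S j)); [lia |].
  assert (H0 : forall m, (m <= j)%nat -> sum_n (G := C_AbelianMonoid) f m = RtoC 0).
  { assert (Hf : forall m, (m <= j)%nat -> f m = RtoC 0).
    { intros m Hm. unfold f. rewrite falling_lt by lia. rewrite Rmult_0_r. ring. }
    induction m as [| m IH]; intros Hm.
    - rewrite sum_O. auto.
    - rewrite sum_Sn, IH, Hf by lia. apply Cplus_0_l. }
  change (is_series (V := C_NormedModule) (fun k => f (S j + k)%nat)
    (l + - sum_n (G := C_AbelianMonoid) f j)%C).
  rewrite H0 by lia. replace (l + - RtoC 0)%C with l by ring. exact Htail.
Qed.

Lemma is_series_sum_n (a : nat -> nat -> C) (l : nat -> C) (N : nat) :
  (forall j, is_series (V := C_NormedModule) (a j) (l j)) ->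
  is_series (V := C_NormedModule)
    (fun n => sum_n (G := C_AbelianMonoid) (fun j => a j n) N)
    (sum_n (G := C_AbelianMonoid) l N).
Proof.
  intros Ha. induction N as [| N IH].
  - rewrite sum_O. generalize (Ha 0%nat). apply is_series_ext.
    intros n. now rewrite sum_O.
  - rewrite sum_Sn.
    generalize (is_series_plus (V := C_NormedModule) _ _ _ _ IH (Ha (S N))).
    apply is_series_ext. intros n. now rewrite sum_Sn.
Qed.

Lemma RtoC_sum_n (a : nat -> R) (N : nat) :
  RtoC (sum_n a N) = sum_n (G := C_AbelianMonoid) (fun j => RtoC (a j)) N.
Proof.
  induction N as [| N IH]; [now rewrite !sum_O |].
  rewrite !sum_Sn, <- IH. apply RtoC_plus.
Qed.

Lemma pow_eta_series (r : R) (p : nat) (x : C) :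
  0 <= r -> Cmod x < 2 ->
  is_series (V := C_NormedModule)
    (fun n => RtoC (gbinom r n) * RtoC (INR n ^ p)
              * (RtoC 1 - euler_eta (RtoC (INR n + r + 1))) * x ^ n)%C
    (RtoC (/ Gamma (r + 1))
       * sum_n (G := C_AbelianMonoid)
           (fun j =>
              (RtoC (INR (stirling2 p j)) * RtoC (Gamma (r + INR j + 1))
                 * eta (RtoC (r + INR j + 1)) (RtoC 2 - x) * x ^ j)%C)
           p)%C.
Proof.
  intros Hr Hx.
  assert (H := is_series_sum_n _ _ p (fun j =>
    is_series_scal (V := C_NormedModule) (RtoC (INR (stirling2 p j))) _ _
      (falling_eta_series r x j Hr Hx))).
  match type of H with is_series _ ?b => match goal with |- is_series _ ?c =>
    replace c with b end end.
  - revert H. apply is_series_ext. intros n.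
    rewrite (pow_stirling2 (INR n) p), RtoC_sum_n.
    set (e := (RtoC 1 - euler_eta (RtoC (INR n + r + 1)))%C).
    transitivity (sum_n (G := C_AbelianMonoid) (fun j =>
      mult (RtoC (gbinom r n) * e * x ^ n)%C
        (RtoC (INR (stirling2 p j) * falling (INR n) j))) p).
    + apply sum_n_ext. intros j. rewrite !RtoC_mult.
      match goal with |- @eq _ (scal ?a ?b) (mult ?c ?d) =>
        change (@eq C (a * b)%C (c * d)%C) end.
      ring.
    + rewrite (sum_n_mult_l (K := C_Ring)).
      match goal with |- @eq _ (mult ?a (sum_n ?u p)) ?c =>
        change (@eq C (a * sum_n (G := C_AbelianMonoid) u p)%C c) end.
      ring.
  - transitivity (sum_n (G := C_AbelianMonoid) (fun j => mult (RtoC (/ Gamma (r + 1)))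
       (RtoC (INR (stirling2 p j)) * RtoC (Gamma (r + INR j + 1))
                 * eta (RtoC (r + INR j + 1)) (RtoC 2 - x) * x ^ j)%C) p).
    + apply sum_n_ext. intros j.
      match goal with |- @eq _ (scal ?a ?b) (mult ?c ?d) =>
        change (@eq C (a * b)%C (c * d)%C) end.
      ring.
    + apply (sum_n_mult_l (K := C_Ring)).
Qed.

(** * The series identity *)

Theorem proposition24 :
  (forall (r : R) (p : nat) (x : C),
      0 <= r -> Cmod x < 2 ->
      let n0 := match p with O => 0%nat | S _ => 1%nat end in
      is_series (V := C_NormedModule)
        (fun k : nat =>
           let n := (n0 + k)%nat in
           (RtoC (gbinom r n) * RtoC (INR n ^ p)
              * (RtoC 1 - euler_eta (RtoC (INR n + r + 1))) * x ^ n)%C)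
        (RtoC (/ Gamma (r + 1))
           * sum_n (G := C_AbelianMonoid)
               (fun j : nat =>
                  (RtoC (INR (stirling2 p j)) * RtoC (Gamma (r + INR j + 1))
                     * eta (RtoC (r + INR j + 1)) (RtoC 2 - x) * x ^ j)%C)
               p)%C)
  /\
  (forall x : C,
      Cmod x < 2 ->
      is_series (V := C_NormedModule)
        (fun n : nat => ((RtoC 1 - euler_eta (RtoC (INR n + 1))) * x ^ n)%C)
        (eta (RtoC 1) (RtoC 2 - x)%C)).
Proof.
  split.
  - intros r p x Hr Hx n0.
    generalize (pow_eta_series r p x Hr Hx).
    destruct p as [| p]; intros H; [exact H |].
    match type of H with is_series _ ?l => set (L := l) in * end.
    apply (is_series_incr_1 (V := C_NormedModule)
      (fun n => RtoC (gbinom r n) * RtoC (INR n ^ S p)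
         * (RtoC 1 - euler_eta (RtoC (INR n + r + 1))) * x ^ n)%C L).
    change (is_series (V := C_NormedModule)
      (fun n => RtoC (gbinom r n) * RtoC (INR n ^ S p)
         * (RtoC 1 - euler_eta (RtoC (INR n + r + 1))) * x ^ n)%C
      (L + RtoC (gbinom r 0) * RtoC (INR 0 ^ S p)
         * (RtoC 1 - euler_eta (RtoC (INR 0 + r + 1))) * x ^ 0)%C).
    (* The term of index 0 vanishes, as [0 ^ S p = 0]. *)
    replace (INR 0 ^ S p) with 0 by (symmetry; apply pow_ne_zero; lia).
    replace (L + _)%C with L by ring. exact H.
  - intros x Hx.
    generalize (eta_series 0 x (Rle_refl 0) Hx). rewrite Rplus_0_l.
    apply is_series_ext. intros n. now rewrite gbinom_r0, Rplus_0_r, Cmult_1_l.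
Qed.
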